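(* Let $(C,\phi)$ be a $4k$-dimensional symmetric Poincaré complex over $\mathbb{Z}$. Then $$\sigma(C,\phi)=\mathcal{P}_2(v_{2k})\in\mathbb{Z}_4,$$ where $v_{2k}\in H^{2k}(C;\mathbb{Z}_2)$ is the $2k$-th algebraic Wu class of $(C,\phi)$ and $\mathcal{P}_2=\mathcal{P}_2(\phi):H^{2k}(C;\mathbb{Z}_2)\to\mathbb{Z}_4$ is the algebraic Pontryagin square.
   Context: Let $W$ be the standard free $\mathbb{Z}[\mathbb{Z}_2]$-module resolution of $\mathbb{Z}$. For a finite-dimensional chain complex $C$ of f.g. projective $\mathbb{Z}$-modules, $C^r=\mathrm{Hom}(C_r,\mathbb{Z})$, and $T\in\mathbb{Z}_2$ acts on $C\otimes C$ by $x\otimes y\mapsto(-1)^{pq}y\otimes x$ ($x\in C_p,y\in C_q$). An $n$-dimensional symmetric structure on $C$ is an $n$-cycle $\phi=\{\phi_s\in(C\otimes C)_{n+s}\mid s\ge0\}$ of $\mathrm{Hom}_{\mathbb{Z}[\mathbb{Z}_2]}(W,C\otimes C)$, i.e. maps $\phi_s:C^{n-r+s}\to C_r$ with $d\phi_s+(-1)^r\phi_sd^*+(-1)^{n+s-1}(\phi_{s-1}+(-1)^sT\phi_{s-1})=0$, $\phi_{-1}=0$. $(C,\phi)$ is Poincaré if $\phi_0:C^{n-*}\to C$ is a chain equivalence. For $n=4k$, $\sigma(C,\phi)$ is the signature of the form $\phi_0$ on $H^{2k}(C)/\mathrm{torsion}$. The algebraic Wu class $v_{2k}\in H^{2k}(C;\mathbb{Z}_2)$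 is the class with $\phi_0(x,x)=\phi_0(x,v_{2k})\in\mathbb{Z}_2$ for all $x\in H^{2k}(C;\mathbb{Z}_2)$. Algebraic Pontryagin square: an element of $H^{2k}(C;\mathbb{Z}_2)$ is represented by $(u,v)$ with $v\in C^{2k}$, $u\in C^{2k+1}$, $d^*v=2u$, $d^*u=0$, and $\mathcal{P}_2(\phi)(u,v)=\phi_0(v,v)+2\phi_1(v,u)\in\mathbb{Z}_4$, where $\phi_s(a,b)$ is the evaluation of $a\otimes b$ on $\phi_s$. *)

(* Defs.v *)
From HB Require Import structures.
From mathcomp Require Import all_boot all_order all_algebra all_field.
From mathcomp Require Import boolp classical_sets.
From mathcomp Require Import ring.

Set Implicit Arguments.
Unset Strict Implicit.
Unset Printing Implicit Defensive.

Import Order.TTheory GRing.Theory Num.Theory.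
Local Open Scope classical_set_scope.
Local Open Scope ring_scope.
Local Open Scope quotient_scope.

(* A Z-module is a zmodType, and a Z-linear map is an additive map. *)

Definition fg_projective (M : zmodType) : Prop :=
  exists m : nat, exists i : {additive M -> 'rV[int]_m},
  exists p : {additive 'rV[int]_m -> M}, cancel i p.

Section Hom.
Variables A B : zmodType.

Lemma additive_ext (f g : {additive A -> B}) : f =1 g -> f = g.
Proof.
case: f g => [f [[cf]]] [g [[cg]]] /= /funext fg.
by subst g; congr GRing.Additive.Pack; congr GRing.Additive.Class;
   congr GRing.isNmodMorphism.Axioms_; exact: Prop_irrelevance.
Qed.

HB.instance Definition _ := gen_eqMixin {additive A -> B}.
HB.instance Definition _ := gen_choiceMixin {additive A -> B}.

Definition hom0 : {additive A -> B} := \0%R.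
Definition hom_add (f g : {additive A -> B}) : {additive A -> B} := f \+ g.
Definition hom_opp (f : {additive A -> B}) : {additive A -> B} := \- f.

Fact hom_addA : associative hom_add.
Proof. by move=> f g h; apply: additive_ext => x /=; rewrite addrA. Qed.
Fact hom_addC : commutative hom_add.
Proof. by move=> f g; apply: additive_ext => x /=; rewrite addrC. Qed.
Fact hom_add0 : left_id hom0 hom_add.
Proof. by move=> f; apply: additive_ext => x /=; rewrite add0r. Qed.
Fact hom_addN : left_inverse hom0 hom_opp hom_add.
Proof. by move=> f; apply: additive_ext => x /=; rewrite addNr. Qed.

HB.instance Definition _ := GRing.isZmodule.Build {additive A -> B}
  hom_addA hom_addC hom_add0 hom_addN.

Lemma hom0E x : (0 : {additive A -> B}) x = 0. Proof. by []. Qed.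
Lemma homDE (f g : {additive A -> B}) x : (f + g) x = f x + g x.
Proof. by []. Qed.
Lemma homNE (f : {additive A -> B}) x : (- f) x = - f x. Proof. by []. Qed.
End Hom.

Section Pullback.
Variables (A A' B : zmodType) (f : {additive A -> A'}).
Definition pullback (g : {additive A' -> B}) : {additive A -> B} := g \o f.
Fact pullback_is_zmod_morphism : zmod_morphism pullback.
Proof. by move=> g h; apply: additive_ext. Qed.
HB.instance Definition _ := GRing.isZmodMorphism.Build _ _ pullback
  pullback_is_zmod_morphism.
End Pullback.

(* To avoid transports along equations between degrees, the differential is a
   family indexed by all pairs of degrees, whose only possibly nonzero
   components are d (r + 1) r : C_{r+1} -> C_r. *)
Record chain_complex := ChainComplex {
  chain_mod :> int -> zmodType;
  diff : forall i j : int, {additive chain_mod i -> chain_mod j};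
  diff_shape : forall i j, i != j + 1 -> forall x, diff i j x = 0;
  diff_diff : forall i j l x, diff j l (diff i j x) = 0
}.

Definition finite_dimensional (C : chain_complex) : Prop :=
  exists N : int, forall i, N < `|i| -> forall x : C i, x = 0.

Definition chain_family (C D : chain_complex) :=
  forall i : int, {additive C i -> D i}.

Definition chain_map (C D : chain_complex) (f : chain_family C D) : Prop :=
  forall i j (x : C i), diff D i j (f i x) = f j (diff C i j x).

Definition chain_homotopic (C D : chain_complex) (f g : chain_family C D) :=
  exists h : forall i j : int, {additive C i -> D j},
  forall r (x : C r),
    f r x - g r x =
      diff D (r + 1) r (h r (r + 1) x) + h (r - 1) r (diff C r (r - 1) x).

Definition chain_equivalence (C D : chain_complex) (f : chain_family C D) :=
  chain_map f /\
  exists g : chain_family D C,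
    [/\ chain_map g,
        chain_homotopic (fun i => g i \o f i : {additive _ -> _})
                        (fun i => idfun : {additive _ -> _}) &
        chain_homotopic (fun i => f i \o g i : {additive _ -> _})
                        (fun i => idfun : {additive _ -> _})].

Notation cochain C G p := {additive chain_mod C p -> G}.

(* d^* : C^p -> C^q, without sign; again only q = p + 1 matters. *)
Definition codiff (C : chain_complex) (G : zmodType) (p q : int) :
  {additive cochain C G p -> cochain C G q} := pullback (diff C q p).
Arguments codiff C G p q : clear implicits.

Section DualComplex.
Variables (C : chain_complex) (n : int).

Definition dual_diff (i j : int) (f : cochain C int (n - i)) :
  cochain C int (n - j) := codiff C int (n - i) (n - j) f *~ (-1) ^ i.

Fact dual_diff_is_zmod_morphism i j : zmod_morphism (@dual_diff i j).
Proof. by move=> f g; rewrite /dual_diff raddfB mulrzBl. Qed.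
HB.instance Definition _ i j :=
  GRing.isZmodMorphism.Build _ _ (@dual_diff i j)
    (@dual_diff_is_zmod_morphism i j).

Fact dual_diff_shape i j : i != j + 1 -> forall f, @dual_diff i j f = 0.
Proof.
move=> ij f; rewrite /dual_diff [codiff _ _ _ _ f](_ : _ = 0) ?mul0rz//.
apply: additive_ext => x /=; rewrite diff_shape ?raddf0//.
by apply: contra ij => /eqP e; rewrite -subr_eq0 -[i](subKr n) -[j](subKr n) e
  !opprB !opprD !addrA; apply/eqP; ring.
Qed.

Fact dual_diff_diff i j l f : @dual_diff j l (@dual_diff i j f) = 0.
Proof.
rewrite /dual_diff raddfMz /= -mulrzA.
rewrite [pullback _ _](_ : _ = 0) ?mul0rz//.
by apply: additive_ext => x /=; rewrite diff_diff raddf0.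
Qed.

(* C^{n-*}, with differential (-1)^r d^* : C^{n-r} -> C^{n-r+1}. *)
Definition dual_complex : chain_complex :=
  @ChainComplex (fun i => cochain C int (n - i))
    (fun i j => @dual_diff i j : {additive _ -> _})
    dual_diff_shape dual_diff_diff.

End DualComplex.

(* The component of s, p, q is the map phi_s : C^p -> C_q, i.e. the component
   of phi_s in C_p (x) C_q under (x (x) y) |-> (f |-> f(x) y); only the
   components with p + q = n + s occur in an n-dimensional structure. *)
Definition symmetric_family (C : chain_complex) :=
  nat -> forall p q : int, {additive cochain C int p -> C q}.

Section SymmetricStructure.
Variables (C : chain_complex) (phi : symmetric_family C).

(* phi_s(a, b), the evaluation of a (x) b on phi_s *)
Definition evaluation (s : nat) (p q : int)
  (a : cochain C int p) (b : cochain C int q) : int := b (phi s p q a).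

(* (T phi_s)(a, b) *)
Definition transposed_evaluation (s : nat) (p q : int)
  (a : cochain C int p) (b : cochain C int q) : int :=
  (-1) ^ (p * q) * evaluation s b a.

(* phi_{s-1} + (-1)^s T phi_{s-1}, with phi_{-1} = 0 *)
Definition symmetrization_pred (s : nat) (p q : int)
  (a : cochain C int p) (b : cochain C int q) : int :=
  if s is s'.+1 then
    evaluation s' a b + (-1) ^+ s * transposed_evaluation s' a b
  else 0.

(* The cycle equation holds in C_r and is tested against all b in C^r, which
   separate the points of C_r when C_r is projective; here p = n - r + s - 1. *)
Definition symmetric_structure (n : int) : Prop :=
  (forall s p q, p + q != n + s%:Z -> forall a, phi s p q a = 0) /\
  (forall (s : nat) (p r : int), p = n - r + s%:Z - 1 ->
     forall (a : cochain C int p) (b : cochain C int r),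
     b (diff C (r + 1) r (phi s p (r + 1) a))
     + (-1) ^ r * b (phi s (p + 1) r (codiff C int p (p + 1) a))
     + (-1) ^ (n + s%:Z - 1) * symmetrization_pred s a b = 0).

Definition poincare (n : int) : Prop :=
  chain_equivalence (fun r => phi 0 (n - r) r : {additive dual_complex C n r -> C r}).

End SymmetricStructure.

Section Cohomology.
Variables (C : chain_complex) (G : zmodType) (p : int).

Definition cocycle_pred (f : cochain C G p) : bool :=
  codiff C G p (p + 1) f == 0.

Fact cocycle_zmod_closed : zmod_closed cocycle_pred.
Proof.
split=> [|f g]; first by rewrite inE raddf0.
move=> f0 g0; apply/eqP; rewrite raddfB.
by rewrite (eqP (f0 : codiff C G p (p + 1) f == 0))
           (eqP (g0 : codiff C G p (p + 1) g == 0)) subr0.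
Qed.
HB.instance Definition _ := GRing.isZmodClosed.Build _ cocycle_pred
  cocycle_zmod_closed.

Record cocycle := Cocycle
  { cocycle_val : cochain C G p; _ : cocycle_val \in cocycle_pred }.
HB.instance Definition _ := [isSub for cocycle_val].
HB.instance Definition _ := [Choice of cocycle by <:].
HB.instance Definition _ := [SubChoice_isSubZmodule of cocycle by <:].

Definition coboundary_pred (f : cocycle) : bool :=
  `[< exists g, codiff C G (p - 1) p g = cocycle_val f >].

Fact coboundary_zmod_closed : zmod_closed coboundary_pred.
Proof.
split=> [|f g]; first by apply/asboolT; exists 0; rewrite raddf0.
move=> /asboolW[f' ff'] /asboolW[g' gg']; apply/asboolT; exists (f' - g').
by rewrite raddfB ff' gg'.
Qed.
Definition coboundaries : zmodClosed cocycle := HB.pack coboundary_pred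
  (GRing.isZmodClosed.Build cocycle coboundary_pred coboundary_zmod_closed).

Definition cohomology : zmodType := Quotient.quot coboundaries.

Definition cohomology_class (f : cocycle) : cohomology := \pi f.
Definition representative (x : cohomology) : cochain C G p :=
  cocycle_val (repr x).

End Cohomology.
Arguments cohomology C G%_type p.

Section Torsion.
Variable A : zmodType.

Definition torsion_pred (x : A) : bool :=
  `[< exists2 m : nat, (0 < m)%N & x *+ m = 0 >].

Fact torsion_zmod_closed : zmod_closed torsion_pred.
Proof.
split=> [|x y]; first by apply/asboolT; exists 1%N.
move=> /asboolW[a a0 xa] /asboolW[b b0 yb]; apply/asboolT.
exists (a * b)%N; first by rewrite muln_gt0 a0.
by rewrite mulrnBl mulrnA xa mul0rn mulnC mulrnA yb mul0rn subr0.
Qed.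
Definition torsion : zmodClosed A := HB.pack torsion_pred
  (GRing.isZmodClosed.Build A torsion_pred torsion_zmod_closed).

Definition mod_torsion : zmodType := Quotient.quot torsion.

End Torsion.

(* The spectral diagonal lists the eigenvalues, with multiplicity, of the real
   symmetric matrix A. *)
Definition mx_signature (m : nat) (A : 'M[int]_m) : int :=
  let ev := spectral_diag (map_mx intr A : 'M[algC]_m) in
  #|[pred i | 0 < ev 0 i]|%:Z - #|[pred i | ev 0 i < 0]|%:Z.

Definition zbasis (A : zmodType) (m : nat) (e : 'I_m -> A) : Prop :=
  forall x, exists! c : 'rV[int]_m, x = \sum_i e i *~ c 0 i.

(* The signature of the Gram matrix in a Z-basis; by Sylvester's law of inertia
   it does not depend on the basis. *)
Definition form_signature (A : zmodType) (beta : A -> A -> int) : int :=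
  xget 0 [set sg | exists m (e : 'I_m -> A), zbasis e /\
                   sg = mx_signature (\matrix_(i, j) beta (e i) (e j))].

Section Invariants.
Variables (C : chain_complex) (phi : symmetric_family C).

Definition cohomology_form (p : int) (x y : cohomology C int p) : int :=
  evaluation phi 0 (representative x) (representative y).

Definition signature (k : int) : int :=
  form_signature (fun x y : mod_torsion (cohomology C int (2 * k)) =>
    cohomology_form (repr x) (repr y)).

(* The mod 2 reduction of the integral cochain a is a cocycle in the class x. *)
Definition lifts (p : int) (a : cochain C int p) (x : cohomology C 'Z_2 p) :=
  exists2 f : cocycle C 'Z_2 p,
    cohomology_class f = x & forall c, cocycle_val f c = (a c)%:~R.

(* phi_0(x, y) in Z_2: the common value of phi_0(a, b) mod 2 over all integral
   lifts a, b of x, y *)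
Definition mod2_form (p : int) (x y : cohomology C 'Z_2 p) : 'Z_2 :=
  xget 0 [set z | forall a b : cochain C int p,
                  lifts a x -> lifts b y -> z = (evaluation phi 0 a b)%:~R].

Definition wu_class (k : int) (v : cohomology C 'Z_2 (2 * k)) : Prop :=
  forall x, mod2_form x x = mod2_form x v.

Definition represents (p : int) (u : cochain C int (p + 1))
  (v : cochain C int p) (x : cohomology C 'Z_2 p) : Prop :=
  [/\ codiff C int p (p + 1) v = u *+ 2,
      codiff C int (p + 1) (p + 1 + 1) u = 0 & lifts v x].

(* The common value of phi_0(v, v) + 2 phi_1(v, u) mod 4 over all pairs (u, v)
   representing x *)
Definition pontryagin_square (p : int) (x : cohomology C 'Z_2 p) : 'Z_4 :=
  xget 0 [set z | forall u v, represents u v x ->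
                  z = (evaluation phi 0 v v + 2 * evaluation phi 1 v u)%:~R].

End Invariants.

(* Main.v *)
From HB Require Import structures.
Require Import Defs.
From mathcomp Require Import all_boot all_order all_algebra all_field.
From mathcomp Require Import boolp classical_sets.
From mathcomp Require Import ring perm.
Set Implicit Arguments.
Unset Strict Implicit.
Unset Printing Implicit Defensive.
Import Order.TTheory GRing.Theory Num.Theory.
Local Open Scope ring_scope.

(** The idea is to replace the mod 2 Wu class by an integral cocycle, and the
    Pontryagin square by an ordinary self-intersection number.

    Let m = 2k, and let L be H^m(C;Z) modulo torsion with the form phi_0, which
    is symmetric, and unimodular by Poincare duality. Let V be an integral
    cochain lifting the Wu class v.

    - The Wu class always has an integral lift. For an integral cocycle a,
      phi_0(a,V) = phi_0(a,a) mod 2, and this vanishes when a is torsion. So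
      the mod 2 homology class dual to v is annihilated by all torsion
      cocycles; by the divisibility criterion [image_divisibility] its integral
      Bockstein is zero, hence it comes from an integral cycle, and duality
      carries that cycle back to an integral cocycle x reducing to v
      ([wu_class_integral_lift]).
    - For a class with an integral lift x, the structure equation for phi_1
      shows that every pair (u,v') representing v gives
      phi_0(v',v') + 2 phi_1(v',u) = phi_0(x,x) mod 4
      ([pontryagin_square_integral]).
    - The class of x in L is characteristic for phi_0. It remains to show
      that a unimodular lattice has signature congruent mod 4 to the square of
      a characteristic vector ([form_signature_mod4]). If A is the Gram
      matrix, of size r and with q negative eigenvalues, the signature is
      r - 2q, while det A = (-1)^q = 1 - 2q mod 4; so the signature is
      r + det A - 1 mod 4. That the square of a characteristic vector is
      r + det A - 1 as well is a statement about symmetric matrices over Z/4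
      ([unimodular_char_square]), proved by splitting off blocks of rank 1
      and 2. *)

(** * Characteristic vectors of unimodular forms over Z/4 *)

(** Doubling turns a congruence mod 2 into an equation in Z/4, so no second
    coefficient ring is involved. *)
Definition characteristic (R : pzRingType) (m : nat) (A : 'M[R]_m)
  (w : 'rV[R]_m) : Prop :=
  forall x : 'rV[R]_m, (x *m A *m x^T) *+ 2 = (x *m A *m w^T) *+ 2.

Definition char_square_formula (m : nat) (A : 'M['Z_4]_m) : Prop :=
  forall w, characteristic A w -> w *m A *m w^T = (m%:R + \det A - 1)%:M.

Lemma Z4_cases (P : 'Z_4 -> Prop) :
  P 0 -> P 1 -> P 2%:R -> P 3%:R -> forall a, P a.
Proof.
move=> P0 P1 P2 P3 [[|[|[|[|//]]]] lt_a4].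
- by rewrite (_ : Ordinal _ = 0) //; apply: val_inj.
- by rewrite (_ : Ordinal _ = 1) //; apply: val_inj.
- by rewrite (_ : Ordinal _ = 2%:R) //; apply: val_inj.
- by rewrite (_ : Ordinal _ = 3%:R) //; apply: val_inj.
Qed.

Lemma Z4_unit_double (a : 'Z_4) : (a \is a GRing.unit) = (a *+ 2 != 0).
Proof. by move: a; apply: Z4_cases. Qed.

Lemma Z4_unit_sqr (a : 'Z_4) : a \is a GRing.unit -> a * a = 1.
Proof. by move: a; apply: Z4_cases => // _; apply: val_inj. Qed.

(** A change of basis multiplies the determinant by the square of a unit of
    Z/4, which is 1. *)
Lemma char_square_formula_congr m (U A : 'M['Z_4]_m) :
  U \in unitmx -> char_square_formula (U *m A *m U^T) -> char_square_formula A.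
Proof.
move=> Uu BA w wA.
have e (x y : 'rV['Z_4]_m) :
    x *m A *m y^T = (x *m invmx U) *m (U *m A *m U^T) *m (y *m invmx U)^T.
  rewrite trmx_mul !mulmxA (mulmxKV Uu) -(mulmxA _ U^T) -trmx_mul (mulVmx Uu).
  by rewrite trmx1 mulmx1.
rewrite e BA => [|x].
  rewrite !det_mulmx det_tr mulrAC Z4_unit_sqr ?mul1r //.
by have := wA (x *m U); rewrite !e mulmxK.
Qed.

(** The determinant is multiplicative while the formula has to be additive; this
    is consistent since (d - 1)(d' - 1) = 0 for odd d and d' in Z/4. *)
Lemma char_square_formula_sum m n (N : 'M['Z_4]_m) (D : 'M['Z_4]_n) :
  \det N \is a GRing.unit -> \det D \is a GRing.unit ->
  char_square_formula N -> char_square_formula D ->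
  char_square_formula (block_mx N 0 0 D).
Proof.
move=> Nu Du BN BD w; rewrite -[w]hsubmxK.
set w1 := lsubmx w; set w2 := rsubmx w => wA.
have e (x1 y1 : 'rV_m) (x2 y2 : 'rV_n) :
    row_mx x1 x2 *m block_mx N 0 0 D *m (row_mx y1 y2)^T
    = x1 *m N *m y1^T + x2 *m D *m y2^T.
  by rewrite mul_row_block !mulmx0 addr0 add0r tr_row_mx mul_row_col.
have w1N : characteristic N w1.
  by move=> x; have := wA (row_mx x 0); rewrite !e !mul0mx !addr0.
have w2D : characteristic D w2.
  by move=> x; have := wA (row_mx 0 x); rewrite !e !mul0mx !add0r.
rewrite e BN // BD // det_ublock -raddfD natrD /=; congr (_%:M).
move: Nu Du (m%:R) (n%:R); move: (\det N) (\det D).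
apply: Z4_cases => //; apply: Z4_cases => // _ _ p q.
- ring.
- ring.
- ring.
- have four0 : 4%:R = 0 :> 'Z_4 by apply: val_inj.
  by apply/eqP; rewrite -subr_eq0 -(mulr0 (-1)) -four0; apply/eqP; ring.
Qed.

(** Schur complement: a unimodular block splits off as an orthogonal summand. *)
Lemma char_square_formula_split m n (A : 'M['Z_4]_(m + n)) :
  A^T = A -> \det A \is a GRing.unit -> \det (ulsubmx A) \is a GRing.unit ->
  char_square_formula (ulsubmx A) ->
  (forall D : 'M['Z_4]_n, D^T = D -> \det D \is a GRing.unit ->
     char_square_formula D) ->
  char_square_formula A.
Proof.
rewrite -{1 2 3 6}[A]submxK; set N := ulsubmx A; set B := ursubmx A.
set B' := dlsubmx A; set D := drsubmx A => Asym Au Nu BN IH.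
have [NT BT DT] : [/\ N^T = N, B'^T = B & D^T = D].
  by move: Asym; rewrite tr_block_mx => /eq_block_mx[].
have Num : N \in unitmx by [].
pose U : 'M['Z_4]_(m + n) := block_mx 1%:M 0 (- (B' *m invmx N)) 1%:M.
have detU : \det U = 1 by rewrite det_lblock !det1 mulr1.
apply: (@char_square_formula_congr _ U); first by rewrite unitmxE detU unitr1.
have UA : U *m block_mx N B B' D *m U^T
          = block_mx N 0 0 (D - B' *m invmx N *m B).
  rewrite tr_block_mx !mulmx_block !(mul1mx, mul0mx, mulmx1, mulmx0, trmx1, trmx0,
     addr0, add0r).
  rewrite mulNmx mulmxKV // addNr mul0mx add0r linearN /= trmx_mul trmx_inv NT.
  by rewrite BT mulmxN mulmxA mulmxV // mul1mx addNr mulNmx addrC.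
have dUA : \det (block_mx N 0 0 (D - B' *m invmx N *m B))
    = \det (block_mx N B B' D) by rewrite -UA !det_mulmx det_tr detU mul1r mulr1.
have Du : \det (D - B' *m invmx N *m B) \is a GRing.unit.
  by move: Au; rewrite -dUA det_ublock unitrM => /andP[].
rewrite UA; apply: char_square_formula_sum => //; apply: IH => //.
rewrite linearB /= DT !trmx_mul trmx_inv NT BT -[in B'](trmxK B') BT.
by rewrite mulmxA.
Qed.

Lemma char_square_formula_rank1 (N : 'M['Z_4]_1) :
  N 0 0 \is a GRing.unit -> char_square_formula N.
Proof.
move=> Nu w /(_ 1%:M) /matrixP/(_ 0 0).
rewrite (mx11_scalar N) (mx11_scalar w) det_scalar1 !tr_scalar_mx -!scalar_mxM.
rewrite mxE [RHS]mxE !mxE eqxx !mulr1n mul1r mulr1 => e; congr (_%:M).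
move: (N 0 0) (w 0 0) Nu e.
by apply: Z4_cases => //; apply: Z4_cases => // _ _; apply: val_inj.
Qed.

Lemma Z4_even_mul (a b : 'Z_4) : a *+ 2 = 0 -> b *+ 2 = 0 -> a * b = 0.
Proof.
by move: a b; apply: Z4_cases => //; apply: Z4_cases => // _ _; apply: val_inj.
Qed.

Lemma Z4_mul_unit_even (a b : 'Z_4) :
  b \is a GRing.unit -> a * b *+ 2 = 0 -> a *+ 2 = 0.
Proof.
move=> bu; rewrite -mulrnAl => /(congr1 ( *%R^~ b^-1)).
by rewrite mulrK // mul0r.
Qed.

(** An even block of rank 2 has determinant -1, so the predicted value is
    2 - 1 - 1 = 0; its characteristic vectors are divisible by 2. *)
Lemma char_square_formula_rank2 (N : 'M['Z_4]_2) :
  N^T = N -> N 0 0 *+ 2 = 0 -> N 1 1 *+ 2 = 0 -> N 0 1 \is a GRing.unit ->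
  \det N \is a GRing.unit /\ char_square_formula N.
Proof.
move=> Nsym N00 N11 N01.
have N10 : N 1 0 = N 0 1 by rewrite -[in LHS]Nsym mxE.
have l01 : lift ord0 ord0 = 1 :> 'I_2 by apply: val_inj.
have l10 : lift (1 : 'I_2) ord0 = 0 by apply: val_inj.
have detN : \det N = -1.
  have -> : \det N = N 0 0 * N 1 1 - N 0 1 * N 0 1.
    rewrite (expand_det_row _ 0) !big_ord_recl big_ord0 /cofactor !det_mx11 !mxE.
    by rewrite l01 l10 N10 /= addn0 expr0 expr1; ring.
  by rewrite Z4_even_mul // Z4_unit_sqr // sub0r.
split=> [|w wN]; first by rewrite detN.
have mulE (x y : 'rV['Z_4]_2) : (x *m N *m y^T) 0 0 =
   x 0 0 * y 0 0 * N 0 0 + x 0 1 * y 0 1 * N 1 1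
   + (x 0 0 * y 0 1 + x 0 1 * y 0 0) * N 0 1.
  rewrite mxE !big_ord_recl big_ord0 !mxE !big_ord_recl !big_ord0 /=.
  by rewrite l01 N10; ring.
have w1 : w 0 1 *+ 2 = 0.
  apply: (Z4_mul_unit_even N01).
  have /matrixP/(_ 0 0) := wN (delta_mx 0 0).
  rewrite !mulmxnE !mulE !mxE /= !(mul0r, mul1r, mulr0, addr0, add0r).
  by rewrite mulrnDl -!mulrnAr N00 mulr0 add0r.
have w0 : w 0 0 *+ 2 = 0.
  apply: (Z4_mul_unit_even N01).
  have /matrixP/(_ 0 0) := wN (delta_mx 0 1).
  rewrite !mulmxnE !mulE !mxE /= !(mul0r, mul1r, mulr0, addr0, add0r).
  by rewrite mulrnDl -!mulrnAr N11 mulr0 add0r.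
apply/matrixP => i j; rewrite !ord1 mulE detN mxE eqxx.
rewrite !(Z4_even_mul w0, Z4_even_mul w1) // !mul0r !addr0 mul0r.
by apply: val_inj.
Qed.

(** Induction on the rank. If some diagonal entry is odd, it splits off as a
    block of rank 1. Otherwise the form is even; since the determinant is odd,
    the first row contains an odd entry, and the two corresponding basis vectors
    span an even unimodular block of rank 2. *)
Theorem unimodular_char_square m (A : 'M['Z_4]_m) :
  A^T = A -> \det A \is a GRing.unit -> char_square_formula A.
Proof.
elim/ltn_ind: m A => -[|m] IH A Asym Au.
  move=> w _; apply/matrixP => i j.
  by rewrite !ord1 !mxE big_ord0 det_mx00 add0r subrr mul0rn.
have perm (s : 'S_m.+1) : let B := \matrix_(i, j) A (s i) (s j) in
    [/\ B^T = B, \det B \is a GRing.unit &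
        char_square_formula B -> char_square_formula A].
  move=> B; have BE : B = perm_mx s *m A *m (perm_mx s)^T.
    rewrite tr_perm_mx -row_permE -col_permE.
    by apply/matrixP => i j; rewrite !mxE.
  split; first by apply/matrixP => i j; rewrite !mxE -[in LHS]Asym mxE.
    rewrite BE !det_mulmx !unitrM det_tr -!unitmxE.
    by rewrite !unitmx_perm andbT unitmxE Au.
  by rewrite BE; apply: char_square_formula_congr; apply: unitmx_perm.
have [i Aii | even_diag] := pickP (fun i => A i i \is a GRing.unit).
  have [Bsym Bu] := perm (tperm 0 i); apply.
  set B := \matrix_(_, _) _ in Bsym Bu *.
  have B00 : (ulsubmx (B : 'M_(1 + m))) 0 0 = A i i.
    by rewrite !mxE (_ : lshift m 0 = 0) ?tpermL //; apply: val_inj.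
  apply: (@char_square_formula_split 1 m) => //.
  - by rewrite det_mx11 B00.
  - by apply: char_square_formula_rank1; rewrite B00.
  - by apply: IH; rewrite ltnS.
have A2 i : A i i *+ 2 = 0.
  by have := even_diag i; rewrite Z4_unit_double => /negbFE/eqP.
have [j A0j] : exists j, A 0 j \is a GRing.unit.
  have [j A0j|no] := pickP (fun j => A 0 j \is a GRing.unit).
    by exists j.
  move: Au; rewrite Z4_unit_double (expand_det_row A 0) -sumrMnl.
  rewrite big1 ?eqxx // => j _; have := no j.
  by rewrite Z4_unit_double -mulrnAl => /negbFE/eqP->; rewrite mul0r.
have j0 : j != 0 by apply: contraTneq A0j => ->; rewrite even_diag.
case: m => [|m] in A IH Asym Au perm even_diag A2 j A0j j0 *.
  by case/eqP: j0; rewrite ord1.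
have [Bsym Bu] := perm (tperm 1 j); apply.
set B := \matrix_(_, _) _ in Bsym Bu *.
have BE (a b : 'I_2) : (ulsubmx (B : 'M_(2 + m))) a b
    = A (tperm 1 j (lshift m a)) (tperm 1 j (lshift m b)) by rewrite !mxE.
have l0 : lshift m (0 : 'I_2) = 0 by apply: val_inj.
have l1 : lshift m (1 : 'I_2) = 1 by apply: val_inj.
have t0 : tperm 1 j 0 = 0 by rewrite tpermD // eq_sym.
have [] := @char_square_formula_rank2 (ulsubmx (B : 'M_(2 + m))).
- by rewrite -[in RHS]Bsym; apply/matrixP => a b; rewrite !mxE.
- by rewrite BE l0 A2.
- by rewrite BE l1 A2.
- by rewrite BE l0 l1 t0 tpermL.
move=> Nu BN; apply: (@char_square_formula_split 2 m) => //.
by apply: IH; rewrite ltnS leqnSn.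
Qed.

(** * The signature of a unimodular lattice modulo 4 *)

Lemma Z4_four : 4%:R = 0 :> 'Z_4. Proof. exact: val_inj. Qed.

Lemma Z4_signr n : (-1) ^+ n = 1 - n%:R *+ 2 :> 'Z_4.
Proof.
elim: n => [|n IH]; first by rewrite mul0rn subr0.
apply/eqP; rewrite exprS IH -subr_eq0 -(mulr0 n%:R) -Z4_four; apply/eqP.
by rewrite -[n.+1]addn1 natrD; ring.
Qed.

Lemma spectral_diag_det m (A : 'M[int]_m)
    (ev := spectral_diag (map_mx intr A : 'M[algC]_m)) :
  A^T = A -> (forall i, ev 0 i \is Num.real) /\ \prod_i ev 0 i = (\det A)%:~R.
Proof.
move=> Asym; rewrite /ev; set Ac := map_mx _ A.
have Aherm : Ac \is hermsymmx.
  apply: realsym_hermsym; last first.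
    by apply/mxOverP => i j; rewrite mxE realz.
  apply/is_hermitianmxP; rewrite expr0 scale1r map_mx_id //.
  by rewrite /Ac map_trmx Asym.
split.
  by move=> i; apply: (mxOverP (hermitian_spectral_diag_real Aherm)).
have /orthomx_spectralP AcE := hermitian_normalmx Aherm.
rewrite -det_map_mx -/Ac [in RHS]AcE !det_mulmx det_inv det_diag.
rewrite mulrAC mulVr ?mul1r //.
by rewrite -unitmxE spectral_unit.
Qed.

(** With q negative eigenvalues among m nonzero ones, the signature is m - 2q
    and the determinant, being a unit, equals its sign (-1)^q = 1 - 2q mod 4. *)
Lemma signature_det m (A : 'M[int]_m) : A^T = A -> \det A \is a GRing.unit ->
  (mx_signature A)%:~R = m%:R + (\det A)%:~R - 1 :> 'Z_4.
Proof.
move=> Asym Au; have [evR evdet] := spectral_diag_det Asym.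
rewrite /mx_signature /=; set ev := spectral_diag _ in evR evdet *.
set pos := [pred i | 0 < ev 0 i]; set neg := [pred i | ev 0 i < 0].
have det0 : (\det A)%:~R != 0 :> algC.
  by rewrite intr_eq0; apply: contraTneq Au => ->; rewrite unitr0.
have ev0 i : ev 0 i != 0.
  by apply: contraNneq det0 => e; rewrite -evdet (bigD1 i) //= e mul0r.
have posE : pos =i predC neg.
  by move=> i; rewrite !inE; have := ev0 i; case: real_ltgt0P (evR i).
have detE : \det A = (-1) ^+ #|neg|.
  have negP : 0 < (-1) ^+ #|neg| * (\det A)%:~R :> algC.
    rewrite -evdet (bigID (mem neg)) /= mulrA -prodrN.
    apply: mulr_gt0; apply: prodr_gt0 => i; rewrite inE ?oppr_gt0 //.
    by move=> ni; have := posE i; rewrite !inE => ->.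
  have [dA|dA] : \det A = 1 \/ \det A = -1.
    by move: Au => /orP[]/eqP ->; [left | right].
    move: negP; rewrite dA mulr1 -signr_odd -(signr_odd int).
    by case: odd => //=; rewrite expr1 ltr0N1.
  move: negP; rewrite dA -signr_odd -(signr_odd int).
  by case: odd => //=; rewrite mul1r ltr0N1.
have -> : #|pos| = #|[predC neg]| by apply: eq_card.
rewrite intrB detE rmorphXn /= rmorphN1 Z4_signr.
have /(congr1 (fun x : nat => x%:R : 'Z_4)) := cardC neg.
rewrite card_ord natrD => <-; rewrite -!pmulrn.
ring.
Qed.

Section Additive.
Variables (A B : zmodType) (f : A -> B) (fB : zmod_morphism f).
Definition additive_of : {additive A -> B} :=
  HB.pack f (GRing.isZmodMorphism.Build A B f fB).
End Additive.

Section Lattices.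
Variable A : zmodType.

Definition zcomb (m : nat) (e : 'I_m -> A) (c : 'rV[int]_m) : A :=
  \sum_i e i *~ c 0 i.

Definition torsion_free : Prop :=
  forall (x : A) (n : int), n != 0 -> x *~ n = 0 -> x = 0.

Definition finitely_generated : Prop :=
  exists m (e : 'I_m -> A), forall x, exists c, x = zcomb e c.

Lemma zcombB m (e : 'I_m -> A) c c' : zcomb e (c - c') = zcomb e c - zcomb e c'.
Proof.
by rewrite /zcomb -sumrB; apply: eq_bigr => i _; rewrite !mxE mulrzBr.
Qed.

Lemma zcomb_mulmx m n (e : 'I_n -> A) (c : 'rV_m) (R : 'M_(m, n)) :
  zcomb e (c *m R) = zcomb (fun j => zcomb e (row j R)) c.
Proof.
rewrite /zcomb; under [RHS]eq_bigr do rewrite mulrz_suml.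
rewrite exchange_big; apply: eq_bigr => i _ /=.
by rewrite mxE mulrz_sumr; apply: eq_bigr => j _; rewrite mxE mulrC mulrzA.
Qed.

(** By induction on the number of generators. The Smith form of a nontrivial
    relation, a matrix with a single row, changes the generators so that the
    relation says that a nonzero multiple of the first one vanishes; by
    torsion-freeness that generator is zero and can be dropped. *)
Lemma torsion_free_zbasis : torsion_free -> finitely_generated ->
  exists m (e : 'I_m -> A), zbasis e.
Proof.
move=> tf [m [e]]; elim: m e => [|m IH] e gen.
  exists 0, e => x; have [c xc] := gen x; exists c; split=> // c' _.
  by apply/rowP => -[].
have [free|/existsNP[c /not_implyP[ec0 /eqP c0]]] :=
    pselect (forall c, zcomb e c = 0 -> c = 0).
  exists m.+1, e => x; have [c xc] := gen x; exists c; split=> // c' xc'.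
  by apply/subr0_eq/free; rewrite zcombB -xc /zcomb -xc' subrr.
have [L _ [R Ru [d _ cE]]] := int_Smith_normal_form c.
pose g j := zcomb e (row j R).
have cR : c = (L 0 0 * d`_0) *: row 0 R.
  apply/rowP => j; rewrite cE !mxE big_ord_recl big1 => [|i _].
    by rewrite !mxE big_ord1 !mxE eqxx addr0.
  by rewrite !mxE big_ord1 !mxE mulr0 mul0r.
have g0 : g 0 = 0.
  apply: (tf _ (L 0 0 * d`_0)).
    by apply: contraNneq c0; rewrite cR => ->; rewrite scale0r.
  rewrite -ec0 cR /g /zcomb mulrz_suml; apply: eq_bigr => i _.
  by rewrite !mxE -mulrzA; congr (_ *~ _); rewrite mulrC.
apply: (IH (g \o lift 0)) => x; have [c' ->] := gen x.
exists (\row_j (c' *m invmx R) 0 (lift 0 j)).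
rewrite -{1}[c'](mulmxKV Ru) zcomb_mulmx -/g {1}/zcomb big_ord_recl.
rewrite g0 mul0rz add0r.
by apply: eq_bigr => i _; rewrite !mxE.
Qed.

Section Forms.
Variable beta : A -> A -> int.
Hypotheses (betaDl : forall x, zmod_morphism (beta^~ x))
           (betaC : forall x y, beta x y = beta y x).

Lemma form_zcomb m (e : 'I_m -> A) c c' :
  beta (zcomb e c) (zcomb e c') =
    (c *m \matrix_(i, j) beta (e i) (e j) *m c'^T) 0 0.
Proof.
have combl m' (f : 'I_m' -> A) b y :
    beta (zcomb f b) y = \sum_i b 0 i * beta (f i) y.
  rewrite -[LHS]/(additive_of (betaDl y) _) raddf_sum; apply: eq_bigr => i _.
  by rewrite raddfMz /= -mulrzr intz mulrC.
rewrite mxE combl; under [RHS]eq_bigr do rewrite mxE mulr_suml.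
rewrite [RHS]exchange_big /=; apply: eq_bigr => i _.
rewrite betaC combl mulr_sumr; apply: eq_bigr => j _.
by rewrite !mxE betaC; ring.
Qed.

(** The van der Blij congruence, modulo 4 only. Unimodularity is stated without
    a basis: every functional is represented by a vector. Applied to the
    coordinate functionals it yields an inverse of the Gram matrix. *)
Theorem form_signature_mod4 w :
  torsion_free -> finitely_generated ->
  (forall f : A -> int, zmod_morphism f -> exists x, beta x =1 f) ->
  (forall x, (2 %| beta x x - beta x w)%Z) ->
  (form_signature beta)%:~R = (beta w w)%:~R :> 'Z_4.
Proof.
move=> tf fg unimodular w_char.
have [m [e [e_basis ->]]] : exists m (e : 'I_m -> A), zbasis e /\
    form_signature beta = mx_signature (\matrix_(i, j) beta (e i) (e j)).
  have [m [e e_basis]] := torsion_free_zbasis tf fg.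
  pose sg := mx_signature (\matrix_(i, j) beta (e i) (e j)).
  apply: (@xgetPex _ 0 [set sg | exists m (e : 'I_m -> A), zbasis e /\
    sg = mx_signature (\matrix_(i, j) beta (e i) (e j))]%classic).
  by exists sg, m, e.
set G := \matrix_(_, _) _.
have Gsym : G^T = G by apply/matrixP => i j; rewrite !mxE betaC.
have /boolp.choice[coord coordE] x : exists c, x = zcomb e c.
  by have [c [xc _]] := e_basis x; exists c.
have coord_comb c : coord (zcomb e c) = c.
  have [c' [_ c'P]] := e_basis (zcomb e c).
  exact: etrans (esym (c'P _ (coordE _))) (c'P _ erefl).
have Gu : \det G \is a GRing.unit.
  have /boolp.choice[x xE] j : exists x, beta x =1 (fun y => coord y 0 j).
    apply: unimodular => y z.
    by rewrite {1}(coordE y) {1}(coordE z) -zcombB coord_comb !mxE.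
  have /mulmx1_unit[] // : (\matrix_j coord (x j)) *m G = 1%:M.
  apply/matrixP => i j.
  have ej : e j = zcomb e (delta_mx 0 j).
    rewrite /zcomb (bigD1 j) //= big1 => [|k kj]; rewrite mxE ?eqxx ?addr0 //.
    by rewrite (negPf kj) mulr0z.
  have := xE i (e j); rewrite {1}(coordE (x i)) ej form_zcomb -/G coord_comb.
  rewrite [delta_mx _ _ _ _]mxE eqxx trmx_delta -colE mxE => xGj.
  transitivity (row i ((\matrix_j coord (x j)) *m G) 0 j).
    by rewrite [RHS]mxE.
  by rewrite row_mul rowK xGj mxE.
rewrite signature_det //.
pose red n p (M : 'M[int]_(n, p)) : 'M['Z_4]_(n, p) := map_mx intr M.
have formE x y : (beta x y)%:~R
    = (red _ _ (coord x) *m red _ _ G *m (red _ _ (coord y))^T) 0 0.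
  rewrite [in LHS](coordE x) [in LHS](coordE y) form_zcomb -/G.
  by rewrite /red map_trmx -!map_mxM [RHS]mxE.
have red_char : characteristic (red _ _ G) (red _ _ (coord w)).
  move=> x; pose x' := zcomb e (map_mx (fun a : 'Z_4 => (a : nat)%:Z) x).
  have -> : x = red _ _ (coord x').
    by rewrite coord_comb; apply/rowP => i; rewrite !mxE -pmulrn natr_Zp.
  apply/matrixP => i j; rewrite (ord1 i) (ord1 j).
  rewrite !mulmxnE -!formE.
  have /dvdzP[q /eqP] := w_char x'; rewrite subr_eq => /eqP->.
  rewrite intrD intrM mulrnDl -mulrnAr (_ : 2%:~R *+ 2 = 0) ?mulr0 ?add0r //.
  exact: val_inj.
have := unimodular_char_square _ _ red_char.
rewrite map_trmx Gsym det_map_mx => /(_ erefl).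
rewrite rmorph_unit // => /(_ isT) /matrixP/(_ 0 0).
by rewrite -formE mxE eqxx => ->.
Qed.
End Forms.
End Lattices.

(** * Integer matrices and dual bases *)

(** The kernel of a map between free groups is a direct summand. In Smith form
    the projection keeps the coordinates whose elementary divisor is zero. *)
Lemma int_kernel_projector m n (M : 'M[int]_(m, n)) :
  exists P : 'M[int]_m, P *m M = 0 /\
    forall x : 'rV[int]_m, x *m M = 0 -> x *m P = x.
Proof.
have [L Lu [R Ru [d _ ->]]] := int_Smith_normal_form M.
set S := \matrix_(_, _) _.
pose K : 'M[int]_m := \matrix_(i, j) ((i == j) && (row i S == 0))%:R.
have KS : K *m S = 0.
  apply/matrixP => i j; rewrite !mxE (bigD1 i) //= big1 => [|k ki]; last first.
    by rewrite mxE eq_sym (negPf ki) mul0r.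
  rewrite mxE eqxx addr0 /=; case: eqP => [/rowP/(_ j)|_]; last by rewrite mul0r.
  by rewrite !mxE => ->; rewrite mulr0.
exists (L *m K *m invmx L); split=> [|x].
  by rewrite !mulmxA mulmxKV // -(mulmxA L) KS mulmx0 mul0mx.
rewrite !mulmxA => /(congr1 (mulmx^~ (invmx R))); rewrite mulmxK // mul0mx.
set y := x *m L => yS; suff -> : y *m K = y by rewrite mulmxK.
apply/rowP => i; rewrite mxE (bigD1 i) //= big1 => [|k ki]; last first.
  by rewrite [X in _ * X]mxE (negPf ki) mulr0.
rewrite [X in _ * X]mxE eqxx addr0 /=.
have [|/rV0Pn[j]] := altP eqP; rewrite ?mulr1 // mxE mulr0 => Sij.
have ij : i = j :> nat.
  by apply/eqP; apply: contraNT Sij => /negPf ij; rewrite mxE ij.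
have Skj k : k != i -> S k j = 0.
  by move=> ki; rewrite mxE -ij (_ : (k == i :> nat) = false) //; apply: negPf.
have /rowP/(_ j) := yS; rewrite [LHS]mxE [RHS]mxE (bigD1 i) //= big1 => [|k ki].
  by rewrite addr0 => /eqP; rewrite mulf_eq0 (negPf Sij) orbF => /eqP.
by rewrite Skj ?mulr0.
Qed.

(** A Fredholm alternative over Z. In Smith form the j-th coordinate functional
    takes on the image exactly the multiples of the j-th elementary divisor, so
    testing with it gives the divisibility needed to solve for the j-th
    coordinate. The modulus q = 0 expresses orthogonality to the cokernel. *)
Lemma int_image_divisibility m n (M : 'M[int]_(m, n)) (y : 'rV[int]_n) :
  (forall (q : int) (b : 'cV[int]_n), (forall i, (q %| ((M *m b) i 0)%R)%Z) ->
     (q %| ((y *m b) 0 0)%R)%Z) ->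
  exists x, y = x *m M.
Proof.
have [L Lu [R Ru [d _ ->]]] := int_Smith_normal_form M.
set S := \matrix_(_, _) _ => y_div.
have [z zE] : exists z, z = y *m invmx R by exists (y *m invmx R).
have zS (j : 'I_n) (q : int) : (forall i, (q %| S i j)%Z) -> (q %| (z 0 j)%R)%Z.
  move=> qS; have := y_div q (col j (invmx R)).
  rewrite colE !mulmxA mulmxK // -zE -(mulmxA L) -!colE mxE; apply=> i.
  rewrite mxE; apply: rpred_sum => k _.
  by rewrite dvdz_mull // mxE.
exists ((\row_i \sum_j (((z 0 j)%R %/ (d`_i)%R)%Z *+ (i == j :> nat))) *m invmx L).
rewrite !mulmxA mulmxKV // -[LHS](mulmxKV Ru) -zE; congr (_ *m R).
apply/rowP => j; rewrite !mxE.
have [jm | mj] := ltnP j m; last first.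
  rewrite big1 => [|i _].
    apply/eqP; rewrite -dvd0z; apply: zS => i.
    by rewrite mxE (ltn_eqF (leq_trans (ltn_ord i) mj)) dvdz0.
  by rewrite [X in _ * X]mxE (ltn_eqF (leq_trans (ltn_ord i) mj)) mulr0.
rewrite (bigD1 (Ordinal jm)) //= [X in _ + X]big1 => [|i ij]; last first.
  by rewrite [X in _ * X]mxE (_ : (i == j :> nat) = false) ?mulr0 //; apply: negPf.
rewrite !mxE eqxx addr0 (bigD1 j) //= eqxx big1 => [|k kj]; last first.
  by rewrite eq_sym (_ : (k == j :> nat) = false) //; apply: negPf.
rewrite addr0 !mulr1n divzK //; apply: zS => i; rewrite mxE.
by have [->|] := eqVneq (i : nat) j; rewrite ?mulr1n ?mulr0n ?dvdz0.
Qed.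

(** The dual basis characterization of finitely generated projective groups;
    unlike a retraction from a free group, it passes to the dual directly. *)
Definition has_dual_basis (A : zmodType) : Prop :=
  exists m (e : 'I_m -> A) (e' : 'I_m -> {additive A -> int}),
    forall x, x = zcomb e (\row_j e' j x).

Lemma zcomb_add (A B : zmodType) (f : {additive A -> B}) m (e : 'I_m -> A) c :
  f (zcomb e c) = zcomb (f \o e) c.
Proof. by rewrite raddf_sum; apply: eq_bigr => i _; rewrite raddfMz. Qed.

Lemma homMzE (A B : zmodType) (f : {additive A -> B}) (n : int) x :
  (f *~ n) x = f x *~ n.
Proof.
have evB : zmod_morphism (fun g : {additive A -> B} => g x) by [].
exact: (raddfMz (additive_of evB)).
Qed.

Lemma homMnE (A B : zmodType) (f : {additive A -> B}) (n : nat) x :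
  (f *+ n) x = f x *+ n.
Proof. exact: (homMzE f n). Qed.

Lemma hom_sumE (A B : zmodType) I r (P : pred I) (F : I -> {additive A -> B}) x :
  (\sum_(i <- r | P i) F i) x = \sum_(i <- r | P i) F i x.
Proof.
have evB : zmod_morphism (fun g : {additive A -> B} => g x) by [].
exact: (raddf_sum (additive_of evB)).
Qed.

Lemma fg_projective_dual_basis A : fg_projective A -> has_dual_basis A.
Proof.
move=> [m [i [p ip]]].
have coordB j : zmod_morphism (fun x : A => i x 0 j).
  by move=> x y; rewrite raddfB !mxE.
exists m, (fun j => p (delta_mx 0 j)), (fun j => additive_of (coordB j)) => x.
rewrite -[LHS]ip (matrix_sum_delta (i x)) big_ord1 raddf_sum.
by apply: eq_bigr => j _; rewrite -[X in X *: _]intz scaler_int raddfMz mxE.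
Qed.

Lemma coord_additive_mulmx (A B : zmodType) (d : {additive A -> B}) m n
    (e : 'I_m -> A) (f' : 'I_n -> {additive B -> int}) (c : 'rV_m) :
  \row_j f' j (d (zcomb e c)) = c *m \matrix_(i, j) f' j (d (e i)).
Proof.
apply/rowP => j; rewrite !mxE zcomb_add zcomb_add; apply: eq_bigr => i _.
by rewrite mxE /= mulrzz mulrC.
Qed.

Lemma zcomb0 (A : zmodType) m (e : 'I_m -> A) : zcomb e 0 = 0.
Proof. by rewrite /zcomb big1 // => i _; rewrite mxE mulr0z. Qed.

Lemma kernel_projector (A B : zmodType) (d : {additive A -> B}) :
  has_dual_basis A -> has_dual_basis B ->
  exists P : {additive A -> A},
    (forall x, d (P x) = 0) /\ (forall x, d x = 0 -> P x = x).
Proof.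
move=> [m [e [e' eE]]] [n [f [f' fE]]].
pose M := \matrix_(i, j) f' j (d (e i)).
have [P [PM PK]] := int_kernel_projector M.
have PB : zmod_morphism (fun x => zcomb e (\row_j e' j x *m P)).
  move=> x y; rewrite -zcombB -mulmxBl; congr (zcomb e (_ *m P)).
  by apply/rowP => j; rewrite !mxE raddfB.
exists (additive_of PB); split=> x.
  by rewrite [LHS]fE coord_additive_mulmx -mulmxA PM mulmx0 zcomb0.
move=> dx; rewrite /= PK -?eE // -coord_additive_mulmx -eE dx.
by apply/rowP => j; rewrite !mxE raddf0.
Qed.

Lemma image_divisibility (A B : zmodType) (d : {additive A -> B}) (y : B) :
  has_dual_basis A -> has_dual_basis B ->
  (forall (q : int) (b : {additive B -> int}),
     (forall x, (q %| b (d x))%Z) -> (q %| b y)%Z) ->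
  exists x, y = d x.
Proof.
move=> [m [e [e' eE]]] [n [f [f' fE]]] y_div.
have [|c cE] := @int_image_divisibility _ _ (\matrix_(i, j) f' j (d (e i)))
  (\row_j f' j y).
  move=> q b qb.
  have bB : zmod_morphism (fun z => ((\row_j f' j z) *m b) 0 0).
    move=> z t; rewrite [X in X *m b](_ : _ = \row_j f' j z - \row_j f' j t).
      by rewrite mulmxBl !mxE.
    by apply/rowP => j; rewrite !mxE raddfB.
  apply: (y_div q (additive_of bB)) => x /=.
  rewrite [x]eE coord_additive_mulmx -mulmxA mxE.
  by apply: rpred_sum => i _; rewrite dvdz_mull.
by exists (zcomb e c); rewrite [RHS]fE coord_additive_mulmx -cE -fE.
Qed.

Lemma dual_has_dual_basis (A : zmodType) :
  has_dual_basis A -> has_dual_basis {additive A -> int}.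
Proof.
move=> [m [e [e' eE]]].
have evB j : zmod_morphism (fun a : {additive A -> int} => a (e j)) by [].
exists m, e', (fun j => additive_of (evB j)) => a.
apply: additive_ext => x; rewrite [in LHS](eE x) zcomb_add hom_sumE.
by apply: eq_bigr => j _; rewrite homMzE !mxE /= !mulrzz mulrC.
Qed.

(** This turns functionals on cochains into chains, to which duality applies. *)
Lemma dual_reflexive (A : zmodType) : has_dual_basis A ->
  forall F : {additive {additive A -> int} -> int}, exists z, forall a, F a = a z.
Proof.
move=> [m [e [e' eE]]] F; exists (zcomb e (\row_j F (e' j))) => a.
have {1}-> : a = zcomb e' (\row_j a (e j)).
  apply: additive_ext => x; rewrite [in LHS](eE x) zcomb_add hom_sumE.
  by apply: eq_bigr => j _; rewrite homMzE !mxE /= !mulrzz mulrC.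
rewrite !zcomb_add; apply: eq_bigr => j _.
by rewrite !mxE /= !mulrzz mulrC.
Qed.

Lemma dual_separated (A : zmodType) (z : A) : has_dual_basis A ->
  (forall a : {additive A -> int}, a z = 0) -> z = 0.
Proof.
move=> [m [e [e' eE]]] z0; rewrite [LHS]eE -[RHS](zcomb0 e).
by congr zcomb; apply/rowP => j; rewrite !mxE z0.
Qed.

Lemma mod2_lift (A : zmodType) : has_dual_basis A ->
  forall f : {additive A -> 'Z_2},
  exists a : {additive A -> int}, forall x, f x = (a x)%:~R.
Proof.
move=> [m [e [e' eE]]] f.
exists (zcomb e' (\row_j (f (e j) : nat)%:Z)) => x.
rewrite [in LHS](eE x) zcomb_add hom_sumE rmorph_sum; apply: eq_bigr => j _.
by rewrite homMzE !mxE /= mulrzz intrM -pmulrn natr_Zp -mulrzr mulrC.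
Qed.

Lemma dvdz_hom (A : zmodType) (b : {additive A -> int}) (q : int) :
  (forall x, (q %| b x)%Z) -> exists h : {additive A -> int}, b = h *~ q.
Proof.
have [->|q0] := eqVneq q 0 => qb.
  by exists 0; apply: additive_ext => x; have := qb x; rewrite dvd0z => /eqP.
have hB : zmod_morphism (fun x => (b x %/ q)%Z).
  move=> x y; apply: (mulIf q0).
  by rewrite mulrBl !divzK // raddfB.
exists (additive_of hB); apply: additive_ext => x.
by rewrite homMzE /= mulrzz divzK.
Qed.

Lemma intr_Z2_eq0 (z : int) : (z%:~R == 0 :> 'Z_2) = (2 %| z)%Z.
Proof.
have char2 : 2%N \in [pchar 'Z_2] by apply: pchar_Fp.
rewrite dvdzE; case: z => k; first by rewrite -pmulrn -(dvdn_pcharf char2).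
by rewrite NegzE mulrNz oppr_eq0 abszN -pmulrn -(dvdn_pcharf char2).
Qed.

Lemma signz_sqr (r : int) : (-1) ^ r * (-1) ^ r = 1 :> int.
Proof. by rewrite -exprzMl // mulrNN mulr1 exp1rz. Qed.

Lemma add_sub_solve (V : zmodType) (x y z w e : V) :
  x + y - e = z + w -> e = (x - z) + (y - w).
Proof. by move=> xye; rewrite addrACA -opprD -xye opprB addrC subrK. Qed.

(** * Duality in a symmetric Poincare complex *)

Section Complex.
Variables (C : chain_complex) (n : int) (phi : symmetric_family C).

Lemma codiff_double_all p (f : cochain C int p) u :
  codiff C int p (p + 1) f = u *+ 2 ->
  forall q, exists u', codiff C int p q f = u' *+ 2.
Proof.
move=> fu q; have [->|qp] := eqVneq q (p + 1); first by exists u.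
by exists 0; apply: additive_ext => x /=; rewrite diff_shape ?raddf0 // homMnE mul0rn.
Qed.

Lemma codiff_codiff (G : zmodType) p q r (f : cochain C G p) :
  codiff C G q r (codiff C G p q f) = 0.
Proof. by apply: additive_ext => x /=; rewrite diff_diff raddf0. Qed.

Hypothesis phi_poincare : poincare phi n.

(** The equalities between degrees are hypotheses, here and below, because
    n - r is not convertible to the degree p in which a cochain is given. *)
Lemma phi0_diff p q r s (f : cochain C int p) : p = n - r -> q = n - s ->
  diff C r s (phi 0 p r f) = phi 0 q s (codiff C int p q f) *~ (-1) ^ r.
Proof.
move=> pE qE; subst p q; have [phi_map _] := phi_poincare.
by have /= -> := phi_map r s f; rewrite raddfMz.
Qed.

Lemma duality_surjective p r (z : C r) : p = n - r ->
  (forall j, diff C r j z = 0) ->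
  exists x : cochain C int p, codiff C int p (p + 1) x = 0 /\
    exists y, z = phi 0 p r x + diff C (r + 1) r y.
Proof.
move=> pE dz; subst p; have [_ [g [g_map _ [h hE]]]] := phi_poincare.
(* cochains of degree n - r + 1 sit in degree r - 1 of the dual complex *)
have [q qE] : exists q, n - r + 1 = n - q by exists (r - 1); ring.
exists (g r z); split.
  have := g_map r q z; rewrite dz raddf0 /= /dual_diff -qE.
  move=> /(congr1 (fun c => c *~ (-1) ^ r)).
  by rewrite mul0rz -mulrzA signz_sqr mulr1z.
exists (- h r (r + 1) z); have := hE r z; rewrite /= dz raddf0 addr0 => hz.
by rewrite raddfN /= -hz opprB addrC subrK.
Qed.

(** Injectivity of duality on mod 2 cohomology, stated with integral cochains:
    a cochain e that is closed mod 2 and whose dual chain is a boundary mod 2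
    is itself a coboundary mod 2. It follows by applying the homotopy inverse
    of phi_0 to the hypothesis. *)
Lemma duality_injective_mod2 p r (e : cochain C int p) u y c : p = n - r ->
  codiff C int p (p + 1) e = u *+ 2 ->
  phi 0 p r e = diff C (r + 1) r y + c *+ 2 ->
  exists (g1 : cochain C int (p - 1)) (g2 : cochain C int p),
    e = codiff C int (p - 1) p g1 + g2 *+ 2.
Proof.
move=> pE eu pe.
suff [q [g1 [g2 [qE ->]]]] :
    exists q (g1 : cochain C int q) (g2 : cochain C int p),
    q = p - 1 /\ e = codiff C int q p g1 + g2 *+ 2.
  by subst q; exists g1, g2.
subst p; have [_ [g [g_map [h hE] _]]] := phi_poincare.
have [u' eu'] := codiff_double_all eu (n - (r - 1)).
exists (n - (r + 1)), ((g (r + 1) y - h r (r + 1) e) *~ (-1) ^ (r + 1)).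
exists (g r c - h (r - 1) r (u' *~ (-1) ^ r)); split; first by ring.
have swap2 : u' *+ 2 *~ (-1) ^ r = u' *~ (-1) ^ r *+ 2.
  by rewrite !pmulrn -!mulrzA mulrC.
have := hE r e; rewrite /= /dual_diff eu' pe swap2.
rewrite raddfD -g_map /= /dual_diff !raddfMn /= => /add_sub_solve eE.
rewrite [LHS]eE mulrnBl; congr (_ + _).
by rewrite -mulrzBl [RHS]raddfMz; congr (_ *~ _); symmetry; apply: raddfB.
Qed.

End Complex.

(** * Integral lifts of mod 2 cohomology classes *)

Lemma intr_Z2_double (z : int) : (z *+ 2)%:~R = 0 :> 'Z_2.
Proof. by apply/eqP; rewrite intr_Z2_eq0 pmulrn mulrzz dvdz_mull. Qed.

Section Lifts.
Variables (C : chain_complex) (p : int).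
Hypothesis C_dual : forall r, has_dual_basis (C r).
Implicit Types (a b : cochain C int p) (x : cohomology C 'Z_2 p).

Lemma lift_exists x : exists a, lifts a x.
Proof.
have [a aE] := mod2_lift (C_dual p) (cocycle_val (repr x)).
by exists a, (repr x) => //; rewrite /cohomology_class reprK.
Qed.

Lemma cocycle_valK (G : zmodType) (f : cocycle C G p) :
  codiff C G p (p + 1) (cocycle_val f) = 0.
Proof. by case: f => f /= /eqP. Qed.

Lemma lifts_codiff a x : lifts a x ->
  exists u, codiff C int p (p + 1) a = u *+ 2.
Proof.
move=> [f _ fa]; have [|u ->] := @dvdz_hom _ (codiff C int p (p + 1) a) 2.
  move=> y; rewrite -intr_Z2_eq0 /= -fa.
  by have /(congr1 (fun g : {additive _ -> _} => g y)) /= -> := cocycle_valK f.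
by exists u; rewrite pmulrn.
Qed.

Lemma lifts_reduction a : codiff C int p (p + 1) a = 0 -> exists x, lifts a x.
Proof.
move=> da; have aB : zmod_morphism (fun c => (a c)%:~R : 'Z_2).
  by move=> c c'; rewrite raddfB intrB.
have f0 : additive_of aB \in cocycle_pred (C := C) (G := 'Z_2) (p := p).
  apply/eqP/additive_ext => y /=.
  by have /(congr1 (fun g : {additive _ -> _} => g y)) /= -> := da.
by exists (cohomology_class (Cocycle f0)), (Cocycle f0).
Qed.

Lemma lifts_unique a b x : lifts a x -> lifts b x ->
  exists (g : cochain C int (p - 1)) (h : cochain C int p),
    b = a + codiff C int (p - 1) p g + h *+ 2.
Proof.
move=> [f fx fa] [f' f'x f'b].
have /asboolP[g0 g0E] : f' - f \in coboundaries C 'Z_2 p.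
  by rewrite Quotient.idealrBE; apply/eqP; exact: etrans f'x (esym fx).
have [g gE] := mod2_lift (C_dual _) g0.
have [|h hE] := @dvdz_hom _ (b - a - codiff C int (p - 1) p g) 2.
  move=> y; rewrite -intr_Z2_eq0 /= !intrB -fa -f'b -gE.
  have /(congr1 (fun g : {additive _ -> _} => g y)) /= -> := g0E.
  by rewrite subrr.
exists g, h; rewrite pmulrn -hE.
by rewrite addrC -[_ - _ - _]addrA -opprD subrK.
Qed.

Lemma lifts_homotopic a b x (g : cochain C int (p - 1)) h :
  lifts a x -> a = b + codiff C int (p - 1) p g + h *+ 2 ->
  codiff C int p (p + 1) b = 0 -> lifts b x.
Proof.
move=> [f fx fa] aE db; have [_ [f' _ f'b]] := lifts_reduction db.
have gB : zmod_morphism (fun c => (g c)%:~R : 'Z_2).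
  by move=> c c'; rewrite raddfB intrB.
exists f' => //; rewrite -fx; apply/eqP; rewrite eq_sym -Quotient.idealrBE.
apply/asboolP; exists (additive_of gB); apply: additive_ext => y /=.
rewrite fa f'b aE /= homMnE intrD intr_Z2_double addr0.
by rewrite intrD [RHS]addrAC subrr add0r.
Qed.
End Lifts.

(** * The Wu class and the Pontryagin square *)

Section QuotientGroup.
Variables (A : zmodType) (I : zmodClosed A).

Definition quotient_class (x : A) : Quotient.quot I :=
  \pi_(Quotient.quot I)%qT x.

Fact quotient_class_zmod_morphism : zmod_morphism quotient_class.
Proof. exact: raddfB. Qed.
HB.instance Definition _ := GRing.isZmodMorphism.Build _ _ quotient_class
  quotient_class_zmod_morphism.

Lemma quotient_classK (t : Quotient.quot I) : quotient_class (repr t) = t.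
Proof. exact: reprK. Qed.

Lemma quotient_class_eq0 x : (quotient_class x == 0) = (x \in I).
Proof.
by rewrite -[x in RHS]subr0 Quotient.idealrBE -[0 in LHS](raddf0 quotient_class).
Qed.
End QuotientGroup.

Section MiddleDimension.
Variables (C : chain_complex) (m n : int) (phi : symmetric_family C).
Hypotheses (mE : m = n - m) (m_even : (-1) ^ (m * m) = 1 :> int)
  (n_even : (-1) ^ n = 1 :> int).
Hypothesis C_dual : forall r, has_dual_basis (C r).
Hypothesis phi_symmetric : symmetric_structure phi n.
Hypothesis phi_poincare : poincare phi n.

Local Notation E a b := (@evaluation C phi 0 m m a b).
Local Notation delta := (codiff C int m (m + 1)).
Local Notation delta' := (codiff C int (m - 1) m).

Lemma evaluationDl a a' b : E (a + a') b = E a b + E a' b.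
Proof. by rewrite /evaluation !raddfD. Qed.
Lemma evaluationMl a b k : E (a *+ k) b = E a b *+ k.
Proof. by rewrite /evaluation !raddfMn. Qed.
Lemma evaluationDr a b b' : E a (b + b') = E a b + E a b'.
Proof. by []. Qed.
Lemma evaluationMr a b k : E a (b *+ k) = E a b *+ k.
Proof. exact: homMnE. Qed.

(** phi_0 descends to cohomology with coefficients Z/q for every q at once;
    q = 0 is the integral case. *)
Lemma evaluation_coboundary (b : cochain C int m) u (q : int) g :
  delta b = u *~ q -> (q %| E (delta' g) b)%Z /\ (q %| E b (delta' g))%Z.
Proof.
move=> bu; split; rewrite /evaluation.
  have p1 : m - 1 = n - (m + 1) by rewrite {1}mE; ring.
  have /(congr1 (fun z => b z *~ (-1) ^ (m + 1))) :=
    phi0_diff phi_poincare g p1 mE.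
  rewrite raddfMz -mulrzA signz_sqr mulr1z => <-.
  rewrite -[b _]/(delta b _) bu homMzE !mulrzz mulrAC; exact: dvdz_mull.
have p1 : m + 1 = n - (m - 1) by rewrite {1}mE; ring.
rewrite /= (phi0_diff phi_poincare b mE p1) bu !raddfMz /= !mulrzz mulrAC.
exact: dvdz_mull.
Qed.

(** The structure equation for s = 1: phi_1 measures the failure of phi_0 to be
    symmetric on cochains. *)
Lemma evaluation_symmetry (a b : cochain C int m) : delta a = 0 ->
  @evaluation C phi 1 m (m + 1) a (delta b) = E b a - E a b.
Proof.
move=> da; have pE : m = n - m + 1%:Z - 1 by rewrite addrK.
have := phi_symmetric.2 1 m m pE a b.
rewrite da !raddf0 mulr0 addr0 addrK n_even mul1r /= expr1 mulN1r.
rewrite /transposed_evaluation m_even mul1r => /eqP.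
by rewrite addr_eq0 opprB => /eqP.
Qed.

Lemma evaluationC (a b : cochain C int m) : delta a = 0 -> delta b = 0 ->
  E a b = E b a.
Proof.
move=> da db; have := evaluation_symmetry b da; rewrite db.
by rewrite /evaluation hom0E => /esym/eqP; rewrite subr_eq0 => /eqP.
Qed.

Lemma mod2_form_lifts x y (a b : cochain C int m) : lifts a x -> lifts b y ->
  mod2_form phi x y = (E a b)%:~R.
Proof.
pose mod2E := [set z : 'Z_2 | forall a b : cochain C int m,
  lifts a x -> lifts b y -> z = (E a b)%:~R]%classic.
move=> ax b_y; suff : mod2E (mod2_form phi x y) by apply.
apply: xgetPex; exists (E a b)%:~R => a' b' a'x b'y.
have [u bu] := lifts_codiff b'y; have [w aw] := lifts_codiff ax.
have [g [h ->]] := lifts_unique C_dual ax a'x.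
have [g' [h' b'E]] := lifts_unique C_dual b_y b'y.
have Z2_dvd (z : int) : (2 %| z)%Z -> z%:~R = 0 :> 'Z_2.
  by rewrite -intr_Z2_eq0 => /eqP.
have [/Z2_dvd gb _] := @evaluation_coboundary b' u 2 g bu.
have [_ /Z2_dvd ag] := @evaluation_coboundary a w 2 g' aw.
rewrite evaluationDl evaluationMl intrD intr_Z2_double addr0.
rewrite evaluationDl intrD gb addr0 b'E evaluationDr evaluationMr.
rewrite intrD intr_Z2_double addr0.
by rewrite evaluationDr intrD ag addr0.
Qed.

Lemma evaluation_coboundary0 (b : cochain C int m) g :
  delta b = 0 -> E (delta' g) b = 0 /\ E b (delta' g) = 0.
Proof.
move=> db; have [] := @evaluation_coboundary b 0 0 g; first by rewrite db mulr0z.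
by rewrite !dvd0z => /eqP ? /eqP ?.
Qed.

Lemma evaluation_torsion (a b : cochain C int m) (q : int) g :
  q != 0 -> a *~ q = delta' g -> delta b = 0 -> E a b = 0 /\ E b a = 0.
Proof.
move=> q0 aq /(evaluation_coboundary0 g)[]; rewrite -aq.
rewrite {1 2}/evaluation raddfMz homMzE raddfMz !mulrzz => /eqP + /eqP.
by rewrite !mulf_eq0 (negPf q0) !orbF => /eqP ? /eqP ?.
Qed.

Lemma wu_class_integral (v : cohomology C 'Z_2 m) (V a : cochain C int m) :
  (forall x, mod2_form phi x x = mod2_form phi x v) -> lifts V v ->
  delta a = 0 -> (2 %| E a a - E a V)%Z.
Proof.
move=> wu Vv da; have [x ax] := lifts_reduction da.
rewrite -intr_Z2_eq0 intrB -(mod2_form_lifts ax ax).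
by rewrite -(mod2_form_lifts ax Vv) wu subrr.
Qed.

(** Here y is the integral Bockstein of the class dual to V. To see that it
    bounds, test it against a functional b whose coboundary is divisible by
    a nonzero q, say q a; then a is a torsion cocycle, so phi_0(a,V) = phi_0(a,a) = 0 mod 2,
    and 2 b(y) = q phi_0(V,a) is divisible by 2q. *)
Lemma wu_class_bockstein (v : cohomology C 'Z_2 m) (V : cochain C int m) u
    (y : C (m - 1)) :
  (forall x, mod2_form phi x x = mod2_form phi x v) -> lifts V v ->
  delta V = u *+ 2 -> diff C m (m - 1) (phi 0 m m V) = y *+ 2 ->
  exists c, y = diff C m (m - 1) c.
Proof.
move=> wu Vv Vu zy; apply: image_divisibility => // q b qb.
have by2 : b y *+ 2 = b (diff C m (m - 1) (phi 0 m m V)) by rewrite zy raddfMn.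
have [q0|q0] := eqVneq q 0.
  by have := qb (phi 0 m m V); rewrite q0 !dvd0z -by2 mulrn_eq0.
have [a aq] := @dvdz_hom _ (delta' b) q qb.
have da : delta a = 0.
  apply: additive_ext => x; apply: (mulIf q0).
  by rewrite mul0r -mulrzz -[LHS]homMzE -raddfMz -aq codiff_codiff.
have [aa _] := evaluation_torsion q0 (esym aq) da.
have /dvdzP[s aVs] := wu_class_integral wu Vv da.
have aV : @evaluation C phi 1 m (m + 1) a u *+ 2 = E V a - E a V.
  by rewrite -evaluation_symmetry // Vu; symmetry; apply: homMnE.
have bz : b y *+ 2 = E V a * q.
  by rewrite by2 -[b _]/(delta' b _) aq homMzE mulrzz.
apply/dvdzP; exists (evaluation phi 1 a u - s); apply: (@mulIf _ 2) => //.
rewrite mulr_natr bz mulrAC mulrBl mulr_natr aV; congr (_ * q).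
by rewrite -[s * 2]aVs aa; ring.
Qed.

(** Since the Bockstein y = d c of the dual chain z is a boundary, z - 2c is a
    cycle with the same reduction mod 2, and it is dual to an integral
    cocycle. *)
Lemma wu_class_integral_lift (v : cohomology C 'Z_2 m) :
  (forall x, mod2_form phi x x = mod2_form phi x v) ->
  exists x : cochain C int m, delta x = 0 /\ lifts x v.
Proof.
move=> wu; have [V Vv] := lift_exists C_dual v.
have [u Vu] := lifts_codiff Vv.
have p1 : m + 1 = n - (m - 1) by rewrite {1}mE; ring.
have zy : diff C m (m - 1) (phi 0 m m V)
    = phi 0 (m + 1) (m - 1) (u *~ (-1) ^ m) *+ 2.
  rewrite (phi0_diff phi_poincare V mE p1) Vu raddfMn raddfMz.
  by rewrite !pmulrn -!mulrzA mulrC.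
have [c yc] := wu_class_bockstein wu Vv Vu zy.
have dz' j : diff C m j (phi 0 m m V - c *+ 2) = 0.
  have [jm|jm] := eqVneq m (j + 1); last by rewrite diff_shape.
  have -> : j = m - 1 by rewrite jm addrK.
  by rewrite raddfB raddfMn /= zy yc subrr.
have [x [dx [y' z'E]]] := duality_surjective phi_poincare mE dz'.
exists x; split=> //.
have [||g1 [g2 eE]] :=
  @duality_injective_mod2 C n phi phi_poincare m m (V - x) u y' c mE.
- by rewrite raddfB Vu dx subr0.
- rewrite [LHS]raddfB /= -[phi 0 m m V](subrK (c *+ 2)) z'E.
  by rewrite addrAC [X in X + _]addrAC subrr add0r.
apply: (@lifts_homotopic _ _ V x v g1 g2) => //.
by rewrite -addrA -eE addrC subrK.
Qed.

(** Any two lifts of v differ by a coboundary and twice a cochain h. In the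
    expansion of the Pontryagin square the terms linear in h combine, through
    the structure equation for phi_1, into a multiple of 4. *)
Lemma pontryagin_square_integral (x : cochain C int m) v :
  delta x = 0 -> lifts x v -> pontryagin_square phi v = (E x x)%:~R.
Proof.
move=> dx xv; pose P2 := [set z : 'Z_4 |
  forall u (v' : cochain C int m), represents u v' v ->
  z = (E v' v' + 2 * evaluation phi 1 v' u)%:~R]%classic.
have rep0 : represents 0 x v by split; rewrite ?dx ?mul0rn ?raddf0.
have -> : (E x x)%:~R
    = (E x x + 2 * @evaluation C phi 1 m (m + 1) x 0)%:~R :> 'Z_4.
  by rewrite [evaluation _ _ _ 0]hom0E mulr0 addr0.
suff : P2 (pontryagin_square phi v) by apply.
apply: xgetPex; exists (E x x)%:~R => u v' [v'u _ v'v].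
have [g [h v'E]] := lifts_unique C_dual xv v'v.
pose y := x + delta' g.
have dy : delta y = 0 by rewrite raddfD dx add0r codiff_codiff.
have uE : u = delta h.
  apply: additive_ext => c; apply: (@mulIf _ 2%:R) => //.
  rewrite !mulr_natr -!homMnE -v'u v'E -/y.
  by rewrite raddfD dy add0r raddfMn.
have [yg _] := evaluation_coboundary0 g dy.
have [_ xg] := evaluation_coboundary0 g dx.
have yy : E y y = E x x.
  by rewrite {1}/y evaluationDl yg addr0 /y evaluationDr xg addr0.
rewrite v'E -/y uE; set t := evaluation phi 1 _ _.
have -> : t = E h y - E y h + evaluation phi 1 h (delta h) *+ 2.
  by rewrite -evaluation_symmetry // /t /evaluation raddfD raddfMn raddfD raddfMn.
rewrite (evaluationDl y) !(evaluationDr _ y) !evaluationMl !evaluationMr yy.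
set p := E y h; set q := E h y; set r := E h h; set s := evaluation phi 1 h _.
have -> : E x x + p *+ 2 + (q *+ 2 + r *+ 2 *+ 2) + 2 * (q - p + s *+ 2)
  = E x x + (q + r + s) * 4 by ring.
by rewrite intrD intrM (_ : 4%:~R = 0) ?mulr0 ?addr0 //; exact: val_inj.
Qed.

(** * The lattice of middle cohomology modulo torsion *)

Definition lattice_class : {additive cocycle C int m ->
    mod_torsion (cohomology C int m)} :=
  @quotient_class _ (torsion (cohomology C int m))
    \o @quotient_class _ (coboundaries C int m).

Definition lattice_repr (t : mod_torsion (cohomology C int m)) : cocycle C int m :=
  repr (repr t : cohomology C int m).

Lemma lattice_reprK t : lattice_class (lattice_repr t) = t.
Proof. by rewrite /= /lattice_repr !quotient_classK. Qed.

Lemma lattice_class_eq0 (a : cocycle C int m) : lattice_class a = 0 ->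
  exists (q : int) g, q != 0 /\ cocycle_val a *~ q = delta' g.
Proof.
move=> /eqP; rewrite quotient_class_eq0 => /asboolP[q q0 /eqP].
rewrite -raddfMn quotient_class_eq0 => /asboolP[g gE].
exists q, g; split; first by rewrite eqz_nat -lt0n.
by rewrite gE; symmetry; apply: (raddfMn \val).
Qed.

Lemma lattice_class_coboundary (a : cocycle C int m) g :
  cocycle_val a = delta' g -> lattice_class a = 0.
Proof.
move=> ag; have /eqP a0 : quotient_class (coboundaries C int m) a == 0.
  by rewrite quotient_class_eq0; apply/asboolP; exists g.
by rewrite /lattice_class /= a0 raddf0.
Qed.

Lemma lattice_torsion_free : torsion_free (mod_torsion (cohomology C int m)).
Proof.
move=> t q q0; rewrite -[t]quotient_classK -raddfMz => /eqP.
rewrite quotient_class_eq0 => /asboolP[k k0 tqk].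
apply/eqP; rewrite quotient_class_eq0; apply/asboolP.
exists (`|q| * k)%N; first by rewrite muln_gt0 absz_gt0 q0.
by rewrite pmulrn PoszM abszEsg -mulrA mulrC !mulrzA -pmulrn tqk mul0rz.
Qed.

Definition lattice_form (s t : mod_torsion (cohomology C int m)) : int :=
  cohomology_form phi (repr s) (repr t).

Lemma lattice_formE (a b : cocycle C int m) :
  lattice_form (lattice_class a) (lattice_class b)
  = E (cocycle_val a) (cocycle_val b).
Proof.
rewrite -[LHS]/(E (cocycle_val (lattice_repr (lattice_class a)))
                  (cocycle_val (lattice_repr (lattice_class b)))).
have E_repr (c d : cocycle C int m) :
    E (cocycle_val (lattice_repr (lattice_class c))) (cocycle_val d)
    = E (cocycle_val c) (cocycle_val d).
  have [|q [g [q0 gE]]] := @lattice_class_eq0 (lattice_repr (lattice_class c) - c).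
    by rewrite raddfB [X in X - _]lattice_reprK subrr.
  have [+ _] := evaluation_torsion q0 gE (cocycle_valK d).
  by rewrite /evaluation !raddfB => /eqP; rewrite subr_eq0 => /eqP.
by rewrite E_repr evaluationC ?cocycle_valK // E_repr evaluationC ?cocycle_valK.
Qed.

(** The cocycles are a direct summand of the cochains, since the coboundaries
    lie in a free group. *)
Lemma cocycle_projector : exists P : {additive cochain C int m -> cocycle C int m},
  forall a, P (cocycle_val a) = a.
Proof.
have [P0 [dP P0K]] := kernel_projector delta (dual_has_dual_basis (C_dual m))
  (dual_has_dual_basis (C_dual (m + 1))).
have dP' a : P0 a \in cocycle_pred (C := C) (G := int) (p := m) by apply/eqP.
have PB : zmod_morphism (fun a => Cocycle (dP' a)).
  by move=> a b; apply: val_inj; rewrite /= raddfB.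
exists (additive_of PB) => a; apply: val_inj => /=.
by rewrite P0K // cocycle_valK.
Qed.

Lemma lattice_finitely_generated :
  finitely_generated (mod_torsion (cohomology C int m)).
Proof.
have [P PK] := cocycle_projector.
have [k [e [e' eE]]] := dual_has_dual_basis (C_dual m).
exists k, (lattice_class \o (P \o e)) => t.
exists (\row_j e' j (cocycle_val (lattice_repr t))).
by rewrite -!zcomb_add -eE PK lattice_reprK.
Qed.

(** A functional on the lattice, extended to all cochains by the projection onto
    cocycles, is evaluation on a chain z. It kills coboundaries, so z is a
    cycle, and the cocycle dual to z represents the functional. *)
Lemma lattice_form_unimodular (f : mod_torsion (cohomology C int m) -> int) :
  zmod_morphism f -> exists s, lattice_form s =1 f.
Proof.
move=> fB; have [P PK] := cocycle_projector.
have [z zE] := dual_reflexive (C_dual m) (additive_of fB \o lattice_class \o P).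
have dz : diff C m (m - 1) z = 0.
  apply: (dual_separated (C_dual _)) => b.
  have db : delta' b \in cocycle_pred (C := C) (G := int) (p := m).
    by apply/eqP; apply: codiff_codiff.
  have := zE (delta' b); rewrite /= => <-.
  have /= := PK (Cocycle db); rewrite -/(delta' b) => ->.
  rewrite [quotient_class _ _](@lattice_class_coboundary (Cocycle db) b) //.
  exact: (raddf0 (additive_of fB)).
have dz' j : diff C m j z = 0.
  have [jm|jm] := eqVneq m (j + 1); last by rewrite diff_shape.
  by have -> : j = m - 1 by rewrite jm addrK.
have [x [dx [y zxy]]] := duality_surjective phi_poincare mE dz'.
have dx' : x \in cocycle_pred (C := C) (G := int) (p := m) by apply/eqP.
exists (lattice_class (Cocycle dx')) => t.
rewrite -[t]lattice_reprK lattice_formE.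
set a := lattice_repr t.
have := zE (cocycle_val a); rewrite /= PK => ->.
rewrite zxy raddfD /=.
have /(congr1 (fun g : {additive _ -> _} => g y)) /= -> := cocycle_valK a.
by rewrite addr0.
Qed.

Theorem signature_pontryagin_square (v : cohomology C 'Z_2 m) :
  (forall x, mod2_form phi x x = mod2_form phi x v) ->
  (form_signature lattice_form)%:~R = pontryagin_square phi v.
Proof.
move=> wu.
have [x [dx xv]] := wu_class_integral_lift wu.
rewrite (pontryagin_square_integral dx xv).
have dx' : x \in cocycle_pred (C := C) (G := int) (p := m) by apply/eqP.
rewrite -[E x x]/(E (cocycle_val (Cocycle dx')) (cocycle_val (Cocycle dx'))).
rewrite -lattice_formE.
apply: form_signature_mod4.
- move=> t s1 s2; rewrite -[s1]lattice_reprK -[s2]lattice_reprK -[t]lattice_reprK.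
  by rewrite -raddfB !lattice_formE /evaluation !raddfB.
- move=> s t; rewrite -[s]lattice_reprK -[t]lattice_reprK !lattice_formE.
  by rewrite evaluationC ?cocycle_valK.
- exact: lattice_torsion_free.
- exact: lattice_finitely_generated.
- exact: lattice_form_unimodular.
- move=> t; rewrite -[t]lattice_reprK !lattice_formE.
  exact: (wu_class_integral wu xv (cocycle_valK _)).
Qed.
End MiddleDimension.

Theorem proposition4p1p2 (C : chain_complex) (k : int) (phi : symmetric_family C)
    (C_finite : finite_dimensional C)
    (C_projective : forall r, fg_projective (C r))
    (phi_symmetric : symmetric_structure phi (4 * k))
    (phi_poincare : poincare phi (4 * k))
    (v : cohomology C 'Z_2 (2 * k)) (v_wu : wu_class phi v) :
  (signature phi k)%:~R = pontryagin_square phi v.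
Proof.
have nE : 2 * k = 4 * k - 2 * k by ring.
have even_sign j : (-1) ^ (2 * j) = 1 :> int by rewrite -exprz_exp exp1rz.
apply: (signature_pontryagin_square nE) => //.
- by rewrite -mulrA even_sign.
- by rewrite (_ : 4 * k = 2 * (2 * k)) ?even_sign //; ring.
- by move=> r; apply: fg_projective_dual_basis.
Qed.
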